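(* For $n\ge2$, the Artin group $A_{B_n}$ of type $B_n$ is locally indicable if and only if $n\le4$.
   Context: $A_{B_n}$ ($n\ge2$) is the group with generators $a_1,\dots,a_n$ and relations $a_ia_j=a_ja_i$ for $|i-j|\ge2$, $a_ia_{i+1}a_i=a_{i+1}a_ia_{i+1}$ for $1\le i\le n-2$, and $a_{n-1}a_na_{n-1}a_n=a_na_{n-1}a_na_{n-1}$. A group $G$ is locally indicable if every nontrivial finitely generated subgroup $H$ of $G$ admits a nontrivial homomorphism $H\to\mathbb{Z}$. *)

(* Defs.v *)
From HB Require Import structures.
From mathcomp Require Import all_boot all_order all_algebra.
From mathcomp Require Import boolp classical_sets.

Set Implicit Arguments.
Unset Strict Implicit.
Unset Printing Implicit Defensive.

Local Open Scope quotient_scope.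

(* A letter (x, b) is the generator x if b = false, its formal inverse
   if b = true. *)
Definition word (X : Type) := seq (X * bool).

Definition gen (X : Type) (x : X) : X * bool := (x, false).

Definition inv_letter (X : Type) (l : X * bool) : X * bool := (l.1, ~~ l.2).

Definition inv_word (X : Type) (w : word X) : word X :=
  rev (map (@inv_letter X) w).

(* [pres_eq R u v]: the words u and v are equal in the group
   < X | u = v for all u, v with R u v >. *)
Inductive pres_eq (X : Type) (R : word X -> word X -> Prop) :
    word X -> word X -> Prop :=
| pres_refl u : pres_eq R u u
| pres_sym u v : pres_eq R u v -> pres_eq R v u
| pres_trans v u w : pres_eq R u v -> pres_eq R v w -> pres_eq R u w
| pres_cat u u' v v' :
    pres_eq R u u' -> pres_eq R v v' -> pres_eq R (u ++ v) (u' ++ v')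
| pres_cancel l : pres_eq R [:: l; inv_letter l] [::]
| pres_rel u v : R u v -> pres_eq R u v.

Section PresentedGroup.
Variables (X : choiceType) (R : word X -> word X -> Prop).

Definition pres_eqb : rel (seq (X * bool)) := fun u v => `[< pres_eq R u v >].

Lemma pres_eqb_refl : reflexive pres_eqb.
Proof. by move=> u; apply/asboolP; apply: pres_refl. Qed.

Lemma pres_eqb_sym : symmetric pres_eqb.
Proof. by move=> u v; apply/asboolP/asboolP; apply: pres_sym. Qed.

Lemma pres_eqb_trans : transitive pres_eqb.
Proof.
by move=> v u w /asboolP uv /asboolP vw; apply/asboolP; apply: pres_trans vw.
Qed.

Canonical pres_equiv := EquivRel pres_eqb pres_eqb_refl pres_eqb_sym
  pres_eqb_trans.

Definition presented := {eq_quot pres_equiv}.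

HB.instance Definition _ := Choice.on presented.

Definition pres_pi (w : word X) : presented := \pi_({eq_quot pres_equiv}) w.

Definition pres_repr (c : presented) : word X := repr c.

Lemma pres_reprK : cancel pres_repr pres_pi.
Proof. exact: reprK. Qed.

Lemma pres_piP u v : pres_pi u = pres_pi v <-> pres_eq R u v.
Proof.
by split=> [/eqmodP/asboolP | uv] //; apply/eqmodP/asboolP.
Qed.

Lemma pres_piK w : pres_eq R (pres_repr (pres_pi w)) w.
Proof. by apply/pres_piP; rewrite pres_reprK. Qed.

Lemma inv_letterK : involutive (@inv_letter X).
Proof. by case=> x b; rewrite /inv_letter /= negbK. Qed.

Lemma inv_wordK : involutive (@inv_word X).
Proof.
move=> w; rewrite /inv_word map_rev revK -map_comp -[RHS]map_id.
by apply: eq_map => l; apply: inv_letterK.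
Qed.

Lemma pres_mulwV (w : word X) : pres_eq R (w ++ inv_word w) [::].
Proof.
elim: w => [|l w IHw]; first exact: pres_refl.
have -> : (l :: w) ++ inv_word (l :: w) =
    [:: l] ++ (w ++ inv_word w) ++ [:: inv_letter l].
  by rewrite /inv_word /= rev_cons -cats1 catA.
apply: (pres_trans (v := [:: l] ++ [::] ++ [:: inv_letter l])).
  apply: pres_cat; first exact: pres_refl.
  by apply: pres_cat; [exact: IHw | exact: pres_refl].
exact: pres_cancel.
Qed.

Definition pres_one : presented := pres_pi [::].

Definition pres_mul (x y : presented) : presented :=
  pres_pi (pres_repr x ++ pres_repr y).

Definition pres_inv (x : presented) : presented :=
  pres_pi (inv_word (pres_repr x)).

Lemma pres_mulE u v : pres_mul (pres_pi u) (pres_pi v) = pres_pi (u ++ v).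
Proof. by apply/pres_piP; apply: pres_cat; apply: pres_piK. Qed.

Lemma pres_mulA : associative pres_mul.
Proof.
move=> x y z; rewrite -(pres_reprK x) -(pres_reprK y) -(pres_reprK z).
by rewrite !pres_mulE catA.
Qed.

Lemma pres_mul1 : left_id pres_one pres_mul.
Proof. by move=> x; rewrite -(pres_reprK x) pres_mulE. Qed.

Lemma pres_mulx1 : right_id pres_one pres_mul.
Proof. by move=> x; rewrite -(pres_reprK x) pres_mulE cats0. Qed.

Lemma pres_mulxV : right_inverse pres_one pres_inv pres_mul.
Proof.
move=> x; rewrite -{1}(pres_reprK x) pres_mulE.
by apply/pres_piP; apply: pres_mulwV.
Qed.

Lemma pres_mulVx : left_inverse pres_one pres_inv pres_mul.
Proof.
move=> x; rewrite -{2}(pres_reprK x) pres_mulE -{2}(inv_wordK (pres_repr x)).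
by apply/pres_piP; apply: pres_mulwV.
Qed.

HB.instance Definition _ := isGroup.Build presented
  pres_mulA pres_mul1 pres_mulx1 pres_mulVx pres_mulxV.

End PresentedGroup.

(* The ordinal i : 'I_n stands for the generator a_(i+1). *)
Inductive artinB_rel (n : nat) : word 'I_n -> word 'I_n -> Prop :=
| artinB_comm (i j : 'I_n) : (i.+2 <= j) || (j.+2 <= i) ->
    artinB_rel [:: gen i; gen j] [:: gen j; gen i]
| artinB_braid (i j : 'I_n) : j = i.+1 :> nat -> j.+1 < n ->
    artinB_rel [:: gen i; gen j; gen i] [:: gen j; gen i; gen j]
| artinB_last (i j : 'I_n) : j = i.+1 :> nat -> j.+1 = n ->
    artinB_rel [:: gen i; gen j; gen i; gen j] [:: gen j; gen i; gen j; gen i].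

Definition artinB (n : nat) : groupType := presented (@artinB_rel n).

Section LocallyIndicable.
Variable G : groupType.

Definition subgroup (H : set G) : Prop :=
  [/\ H 1%g, (forall x y, H x -> H y -> H (x * y)%g)
    & (forall x, H x -> H x^-1%g)].

Definition finitely_generated (H : set G) : Prop :=
  exists s : seq G, H = smallest subgroup [set` s]%classic.

(* A homomorphism H -> Z is given by a function on G of which only the
   values on H matter. *)
Definition indicable (H : set G) : Prop :=
  exists phi : G -> int,
    (forall x y, H x -> H y -> phi (x * y)%g = (phi x + phi y)%R)
    /\ (exists2 x, H x & phi x <> 0%R).

Definition locally_indicable : Prop :=
  forall H : set G, subgroup H -> finitely_generated H ->
    (exists2 x, H x & x <> 1%g) -> indicable H.

End LocallyIndicable.

(* Main.v *)
Require Import Defs.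
From HB Require Import structures.
From mathcomp Require Import all_boot all_algebra.
From mathcomp Require Import boolp classical_sets.
From mathcomp Require Import zify.

(* Call a group strongly indicable if every nontrivial subgroup, finitely
   generated or not, has a nonzero homomorphism to Z; this property is
   obviously stable under extensions.  Free groups have it: they embed in the
   matrix polynomials with constant term 1, and on a subgroup H of those the
   lowest positive-degree coefficient that is not identically zero on H is
   additive.  The Artin group of type B_(m+1) is an extension of the braid group
   on m + 1 strands by a free group of rank m + 1, the braid group on 4 strands
   is an extension of the braid group on 3 strands by a free group of rank 2,
   and the latter is an extension of Z by a free group of rank 2.  In each case
   the kernel is shown to be free by an affine action of the whole group on the
   free group, in which the kernel acts by left translations.

   For n >= 5 the group contains s1, ..., s4 satisfying the relations of the
   braid group on 5 strands.  Since s4 commutes with s1 and s2, commutators of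
   elements of <s1, s2> are unchanged when these elements are multiplied by
   powers of s4, so they are commutators in the derived subgroup; this makes the
   derived subgroup perfect, and a suitable finitely generated subgroup of it
   already has no nonzero homomorphism to Z. *)

Set Implicit Arguments.
Unset Strict Implicit.
Unset Printing Implicit Defensive.

Local Open Scope group_scope.

(** * Actions and homomorphisms of presented groups *)

Section Morphisms.
Variables (G H : groupType) (f : G -> H).
Hypothesis fM : {morph f : x y / x * y}.

Lemma morph1 : f 1 = 1.
Proof. by apply: (mulgI (f 1)); rewrite -fM !mulg1. Qed.

Lemma morphV x : f x^-1 = (f x)^-1.
Proof. by apply: (mulgI (f x)); rewrite -fM !mulgV morph1. Qed.

End Morphisms.

Section WordAction.
Variables (X : choiceType) (T : Type) (act : X * bool -> T -> T).

Definition wact (w : word X) (t : T) : T := foldr act t w.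

Lemma wact_cat u v t : wact (u ++ v) t = wact u (wact v t).
Proof. exact: foldr_cat. Qed.

Lemma wact_pres_eq (R : word X -> word X -> Prop) :
    (forall l t, act l (act (inv_letter l) t) = t) ->
    (forall u v, R u v -> wact u =1 wact v) ->
  forall u v, pres_eq R u v -> wact u =1 wact v.
Proof.
move=> actK actR u v; elim=> {u v}.
- by [].
- by move=> u v _ IH t; rewrite IH.
- by move=> u v w _ IH _ IH' t; rewrite IH.
- by move=> u u' v v' _ IH _ IH' t; rewrite !wact_cat IH IH'.
- by move=> l t; apply: actK.
- exact: actR.
Qed.

End WordAction.

Section Presented.
Variables (X : choiceType) (R : word X -> word X -> Prop).
Local Notation G := (presented R).

Definition pgen (x : X) : G := pres_pi R [:: gen x].

Lemma pres_pi_cat u v : pres_pi R (u ++ v) = pres_pi R u * pres_pi R v.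
Proof. by rewrite -pres_mulE. Qed.

Lemma pres_pi_nil : pres_pi R [::] = 1.
Proof. by []. Qed.

Lemma pres_pi_cons l u : pres_pi R (l :: u) =
  (if l.2 then (pgen l.1)^-1 else pgen l.1) * pres_pi R u.
Proof.
rewrite -cat1s pres_pi_cat; congr (_ * _); case: l => x [] //=.
apply: (mulgI (pgen x)); rewrite mulgV -pres_pi_cat.
by apply/pres_piP; apply: (pres_cancel _ (gen x)).
Qed.

Lemma pres_rel_eq u v : R u v -> pres_pi R u = pres_pi R v.
Proof. by move=> uv; apply/pres_piP; apply: pres_rel. Qed.

Lemma presented_ind (P : G -> Prop) :
    P 1 -> (forall x g, P g -> P (pgen x * g)) ->
    (forall x g, P g -> P ((pgen x)^-1 * g)) ->
  forall g, P g.
Proof.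
move=> P1 PM PV g; rewrite -(pres_reprK g).
elim: (pres_repr g) => [|[x []] w IHw]; first exact: P1.
  by rewrite pres_pi_cons; apply: PV.
by rewrite pres_pi_cons; apply: PM.
Qed.

Lemma presented_morph_ext (H : groupType) (f f' : G -> H) :
    {morph f : x y / x * y} -> {morph f' : x y / x * y} ->
  (forall x, f (pgen x) = f' (pgen x)) -> f =1 f'.
Proof.
move=> fM f'M ff'; apply: presented_ind => [|x g IHg|x g IHg].
- by rewrite !morph1.
- by rewrite fM f'M ff' IHg.
- by rewrite fM f'M !morphV // ff' IHg.
Qed.

(** The action is read off a chosen representative word; [pact_pi] shows independence of the choice
    once letters act invertibly and the relations are respected. *)
Definition pact (T : Type) (act : X * bool -> T -> T) (g : G) : T -> T :=
  wact act (pres_repr g).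

Section Action.
Variables (T : Type) (act : X * bool -> T -> T).
Hypothesis actK : forall l t, act l (act (inv_letter l) t) = t.
Hypothesis actR : forall u v, R u v -> wact act u =1 wact act v.

Lemma pact_pi w t : pact act (pres_pi R w) t = wact act w t.
Proof. exact: (wact_pres_eq actK actR (pres_piK R w)). Qed.

Lemma pact1 t : pact act 1 t = t.
Proof. exact: (pact_pi [::]). Qed.

Lemma pactM g h t : pact act (g * h) t = pact act g (pact act h t).
Proof.
rewrite -(pres_reprK g) -(pres_reprK h) -pres_pi_cat !pact_pi.
exact: wact_cat.
Qed.

Lemma pact_gen x t : pact act (pgen x) t = act (gen x) t.
Proof. exact: pact_pi. Qed.

Lemma pact_genV x t : pact act (pgen x)^-1 t = act (inv_letter (gen x)) t.
Proof.
have <- : pres_pi R [:: inv_letter (gen x)] = (pgen x)^-1.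
  by rewrite pres_pi_cons pres_pi_nil mulg1.
exact: pact_pi.
Qed.

End Action.

Section Lift.
Variables (H : groupType) (h : X -> H).

(** A homomorphism to [H] is obtained as an action on [H] by left multiplications, evaluated at
    1. *)
Definition lmul_letter (l : X * bool) (t : H) : H :=
  (if l.2 then (h l.1)^-1 else h l.1) * t.

Definition lift (g : G) : H := pact lmul_letter g 1.

Hypothesis hR : forall u v, R u v ->
  wact lmul_letter u 1 = wact lmul_letter v 1.

Lemma wact_lmul u t : wact lmul_letter u t = wact lmul_letter u 1 * t.
Proof.
by elim: u => [|l u IHu] /=; rewrite ?mul1g // IHu /lmul_letter mulgA.
Qed.

Lemma lmul_letterK l t : lmul_letter l (lmul_letter (inv_letter l) t) = t.
Proof. by case: l => x []; rewrite /lmul_letter /= ?mulKg ?mulVKg. Qed.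

Let lmulR u v : R u v -> wact lmul_letter u =1 wact lmul_letter v.
Proof. by move=> /hR uv t; rewrite wact_lmul uv -wact_lmul. Qed.

Lemma liftM : {morph lift : x y / x * y}.
Proof.
move=> x y; rewrite /lift (pactM lmul_letterK lmulR) /pact.
by rewrite [LHS]wact_lmul.
Qed.

Lemma lift_gen x : lift (pgen x) = h x.
Proof. by rewrite /lift (pact_gen lmul_letterK lmulR) /lmul_letter mulg1. Qed.

End Lift.

End Presented.

Definition no_rel (Y : choiceType) (u v : word Y) := False.

Definition free (Y : choiceType) : groupType := presented (@no_rel Y).

Definition fgen (Y : choiceType) (y : Y) : free Y := pgen (@no_rel Y) y.

Section Free.
Variables (Y : choiceType) (H : groupType).

Definition flift (h : Y -> H) : free Y -> H := @lift Y (@no_rel Y) H h.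

Lemma fliftM h : {morph flift h : x y / x * y}.
Proof. exact: liftM. Qed.

Lemma flift_gen h y : flift h (fgen y) = h y.
Proof. exact: lift_gen. Qed.

End Free.

(** * Strong indicability *)

Section StronglyIndicable.
Variable G : groupType.

Definition strongly_indicable := forall H : set G, subgroup H ->
  (exists2 x, H x & x <> 1) -> indicable H.

Lemma strongly_indicable_locally :
  strongly_indicable -> locally_indicable G.
Proof. by move=> siG H Hsub _; apply: siG. Qed.

End StronglyIndicable.

(** Either [f] is nontrivial on [H], and a homomorphism is pulled back from the image of [H] in [Q],
    or [H] lies in the kernel of [f], where [j] is an injective homomorphism to [F]. *)
Lemma strongly_indicable_ext (G Q F : groupType) (f : G -> Q) (j : G -> F) :
    {morph f : x y / x * y} ->
    (forall x y, f x = 1 -> f y = 1 -> j (x * y) = j x * j y) ->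
    (forall x, f x = 1 -> j x = 1 -> x = 1) ->
  strongly_indicable Q -> strongly_indicable F -> strongly_indicable G.
Proof.
move=> fM jM jI siQ siF H [H1 HM HV] [x0 Hx0 x0N1].
have [[x Hx fxN1]|Hker] := pselect (exists2 x, H x & f x <> 1).
  have [||phi [phiM [_ [z Hz <-] phiz]]] := siQ (f @` H)%classic.
  - split; first by exists 1; rewrite ?morph1.
      by move=> _ _ [y Hy <-] [z Hz <-]; exists (y * z); rewrite ?fM; auto.
    by move=> _ [y Hy <-]; exists y^-1; rewrite ?morphV; auto.
  - by exists (f x) => //; exists x.
  exists (phi \o f); split=> [y y' Hy Hy'|]; last by exists z.
  by rewrite /= fM phiM.
have {Hker} f1 x : H x -> f x = 1.
  by move=> Hx; apply: contra_notP Hker => ?; exists x.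
have j1 : j 1 = 1 by apply: (mulgI (j 1)); rewrite -jM ?mulg1 ?f1.
have [||phi [phiM [_ [z Hz <-] phiz]]] := siF (j @` H)%classic.
- split; first by exists 1.
    by move=> _ _ [y Hy <-] [z Hz <-]; exists (y * z); rewrite ?jM; auto.
  move=> _ [y Hy <-]; exists y^-1; first exact: HV.
  by apply: (mulgI (j y)); rewrite -jM ?f1 ?mulgV //; auto.
- exists (j x0); first by exists x0.
  by move=> /jI e; apply: x0N1; apply: e; apply: f1.
exists (phi \o j); split=> [y y' Hy Hy'|]; last by exists z.
by rewrite /= jM ?f1 // phiM.
Qed.

(* The generator a acts on F by w |-> k_a * al_a(w).  Since
   a = iota(k_a) * s(f a) and conjugation by s(f a) induces al_a on iota(F),
   the map (w, q) |-> iota w * s q intertwines this action with left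
   multiplication, so that g = iota(g 1) * s(f g) for all g. *)
Section SplitExtension.
Variables (X Y : choiceType) (R : word X -> word X -> Prop) (Q : groupType).
Local Notation G := (presented R).
Local Notation F := (free Y).
Variables (f : G -> Q) (s : Q -> G) (iota : F -> G).
Variables (k : X -> F) (al be : X -> F -> F).

Definition aff_letter (l : X * bool) (w : F) : F :=
  if l.2 then be l.1 ((k l.1)^-1 * w) else k l.1 * al l.1 w.

Hypothesis fM : {morph f : x y / x * y}.
Hypothesis sM : {morph s : x y / x * y}.
Hypothesis iM : {morph iota : x y / x * y}.
Hypothesis alK : forall x, cancel (al x) (be x).
Hypothesis beK : forall x, cancel (be x) (al x).
Hypothesis affR : forall u v, R u v -> wact aff_letter u =1 wact aff_letter v.
Hypothesis genE : forall x, pgen R x = iota (k x) * s (f (pgen R x)).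
Hypothesis sfJ : forall x w,
  s (f (pgen R x)) * iota w = iota (al x w) * s (f (pgen R x)).
Hypothesis pact_iota : forall y w,
  pact (R := R) aff_letter (iota (fgen y)) w = fgen y * w.

Lemma aff_letterK l w : aff_letter l (aff_letter (inv_letter l) w) = w.
Proof.
by case: l => x []; rewrite /aff_letter /= ?mulKg ?beK ?alK ?mulVKg.
Qed.

Local Notation A := (pact (R := R) aff_letter).

Lemma pact_iotaE v w : A (iota v) w = v * w.
Proof.
elim/presented_ind: v w => [|y v IHv|y v IHv] w.
- by rewrite (morph1 iM) (pact1 aff_letterK affR) mul1g.
- by rewrite iM (pactM aff_letterK affR) IHv pact_iota mulgA.
rewrite iM (pactM aff_letterK affR) IHv; apply: (mulgI (fgen y)).
rewrite -pact_iota -(pactM aff_letterK affR) -iM mulgV (morph1 iM).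
by rewrite (pact1 aff_letterK affR) -mulgA mulVKg.
Qed.

Lemma split_decomp g w q : iota (A g w) * s (f g * q) = g * (iota w * s q).
Proof.
have gen_step x w' q' : iota (A (pgen R x) w') * s (f (pgen R x) * q') =
    pgen R x * (iota w' * s q').
  rewrite (pact_gen aff_letterK affR) /aff_letter /= iM sM -mulgA.
  by rewrite [iota (al x w') * _]mulgA -sfJ [RHS]mulgA {2}genE !mulgA.
elim/presented_ind: g w q => [|x g IHg|x g IHg] w q.
- by rewrite (pact1 aff_letterK affR) (morph1 fM) !mul1g.
- by rewrite (pactM aff_letterK affR) fM -!mulgA -IHg gen_step.
rewrite -mulgA -IHg (pactM aff_letterK affR) fM (morphV fM) -mulgA.
set w' := A g w; set q' := f g * q.
apply: (mulgI (pgen R x)); rewrite -gen_step !mulVKg.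
rewrite -(pactM aff_letterK affR) mulgV.
by rewrite (pact1 aff_letterK affR).
Qed.

(** On the kernel of [f] the decomposition reads g = iota (A g 1), so [g] acts on [F] as left
    translation by A g 1. Hence g |-> A g 1 is an injective homomorphism there. *)
Lemma strongly_indicable_split :
  strongly_indicable Q -> strongly_indicable F -> strongly_indicable G.
Proof.
have kerE g : f g = 1 -> iota (A g 1) = g.
  move=> fg; have := split_decomp g 1 1.
  by rewrite fg (morph1 iM) mulg1 (morph1 sM) !mulg1.
apply: (@strongly_indicable_ext _ _ _ f (fun g => A g 1)) => //.
  move=> g h fg fh; rewrite (pactM aff_letterK affR).
  by rewrite -{1}(kerE _ fg) pact_iotaE.
by move=> g fg Ag; rewrite -(kerE _ fg) Ag (morph1 iM).
Qed.

End SplitExtension.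

(** * Free groups *)

Section PolynomialFiltration.
Import GRing.Theory.
Local Open Scope ring_scope.
Variables (G : groupType) (m : nat) (mu : G -> {poly 'M[int]_m.+1}).
Hypothesis muM : forall x y, mu (x * y)%g = mu x * mu y.
Hypothesis mu0 : forall x, (mu x)`_0 = 1.
Hypothesis mu_inj : forall x, mu x = 1 -> x = 1%g.

Lemma strongly_indicable_poly : strongly_indicable G.
Proof.
move=> H _ [x0 Hx0 x0N1].
pose nz d := `[< exists2 x, H x & (mu x)`_d.+1 != 0 >].
have exd : exists d, nz d.
  apply: contra_notP x0N1 => nonz; apply: mu_inj; apply/polyP => -[|d].
    by rewrite mu0 coef1.
  rewrite coef1; apply: contra_notP nonz => /eqP xd; exists d.
  by apply/asboolP; exists x0.
case: (ex_minnP exd) => d /asboolP [x Hx xd] dmin.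
have low y k : H y -> (k < d)%N -> (mu y)`_k.+1 = 0.
  move=> Hy kd; apply: contraTeq (kd) => yk; rewrite -leqNgt.
  by apply: dmin; apply/asboolP; exists y.
have [i [j xij]] : exists i j, (mu x)`_d.+1 i j <> 0.
  apply: contra_notP (elimN eqP xd) => nonz; apply/matrixP => i j.
  rewrite mxE; apply: contra_notP nonz => ?; by exists i, j.
exists (fun y => (mu y)`_d.+1 i j); split; last by exists x.
(* Each middle term of the convolution contains a coefficient of [mu y] of positive degree at most
   [d], which vanishes by minimality. *)
move=> y z Hy Hz; rewrite muM coefM big_ord_recl big_ord_recr /=.
rewrite !mu0 subn0 mul1r /bump /= add1n subnn mu0 mulr1 big1 ?add0r.
  by rewrite mxE addrC.
by move=> k _; rewrite /= /bump /= add1n low // mul0r.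
Qed.

End PolynomialFiltration.

(** * A faithful representation of the free group by 2 x 2 matrix polynomials *)

Section FreeGroup.
Import GRing.Theory.
Local Open Scope ring_scope.
Variable Y : countType.

(** The vectors (1, p), with p the code of the generator, are pairwise independent; [fform y] is the
    linear form whose kernel is the line of [fvec y]. *)
Definition fvec (y : Y) : 'cV[int]_2 :=
  \col_i (if i == 0 then 1 else (pickle y)%:Z).

Definition fform (y : Y) : 'rV[int]_2 :=
  \row_i (if i == 0 then - (pickle y)%:Z else 1).

Lemma fform_fvec y z : fform y *m fvec z = ((pickle z)%:Z - (pickle y)%:Z)%:M.
Proof.
apply/matrixP => i j; rewrite !ord1 !mxE !big_ord_recl big_ord0 !mxE /=.
by rewrite mulr1 mul1r addr0 addrC.
Qed.

(* fvec y *m fform y has square zero, so transvec y is a one-parameter group. *)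
Definition transvec (y : Y) (e : int) : {poly 'M[int]_2} :=
  1 + (e *: (fvec y *m fform y))%:P * 'X.

Lemma transvec0 y : transvec y 0 = 1.
Proof. by rewrite /transvec scale0r polyC0 mul0r addr0. Qed.

Lemma transvecD y e e' : transvec y e * transvec y e' = transvec y (e + e').
Proof.
rewrite /transvec scalerDl polyCD; set N := fvec y *m fform y.
have NN : (e *: N) * (e' *: N) = 0.
  rewrite -scalerAl -scalerAr /N -[_ * _]/(_ *m _) mulmxA -(mulmxA (fvec y)).
  by rewrite fform_fvec subrr raddf0 mulmx0 mul0mx !scaler0.
set p := (e *: N)%:P; set q := (e' *: N)%:P.
have pq : p * 'X * (q * 'X) = 0.
  by rewrite mulrA -(mulrA p) -commr_polyX mulrA -polyCM NN polyC0 !mul0r.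
by rewrite mulrDl mul1r mulrDr mulr1 pq addr0 (mulrDl p q) addrAC addrA.
Qed.

Definition transvec_letter (l : Y * bool) (P : {poly 'M[int]_2}) :=
  transvec l.1 (if l.2 then -1 else 1) * P.

(** A variant of the Magnus embedding: the noncommuting variable attached to y is replaced by N_y X,
    where N_y is an integer matrix of rank one and square zero. The inverse of 1 + N_y X is then the
    polynomial 1 - N_y X. *)
Definition magnus (g : free Y) : {poly 'M[int]_2} :=
  pact (R := @no_rel Y) transvec_letter g 1.

Lemma transvec_letterK l P :
  transvec_letter l (transvec_letter (inv_letter l) P) = P.
Proof.
rewrite /transvec_letter mulrA /= transvecD.
by case: l.2; rewrite /= ?addNr ?addrN transvec0 mul1r.
Qed.

Let no_relE u v :
  no_rel u v -> wact transvec_letter u =1 wact transvec_letter v.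
Proof. by []. Qed.

Lemma magnus_pi w : magnus (pres_pi (@no_rel Y) w) = wact transvec_letter w 1.
Proof. exact: (pact_pi transvec_letterK no_relE). Qed.

Lemma wact_transvec w P :
  wact transvec_letter w P = wact transvec_letter w 1 * P.
Proof.
by elim: w => [|l w IHw] /=; rewrite ?mul1r // IHw /transvec_letter mulrA.
Qed.

Lemma magnusM g h : magnus (g * h)%g = magnus g * magnus h.
Proof.
by rewrite /magnus (pactM transvec_letterK no_relE) [LHS]wact_transvec.
Qed.

Lemma coef_transvec y e (P : {poly 'M[int]_2}) k : (transvec y e * P)`_k =
  P`_k + if k is k'.+1 then (e *: (fvec y *m fform y)) * P`_k' else 0.
Proof.
rewrite mulrDl mul1r coefD -mulrA coefCM coefXM.
by case: k => //=; rewrite mulr0.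
Qed.

Lemma magnus0 g : (magnus g)`_0 = 1.
Proof.
rewrite -(pres_reprK g) magnus_pi; elim: (pres_repr g) => [|l w IHw] /=.
  by rewrite coef1.
by rewrite coef_transvec addr0.
Qed.

(** Here [d] is the degree of [P], and the image of the leading coefficient is not contained in the
    line of [fvec y]; so a nontrivial power of the transvection of [y] raises the degree. *)
Definition top_form (y : Y) (P : {poly 'M[int]_2}) : Prop :=
  exists d, (forall k, (d < k)%N -> P`_k = 0) /\ fform y *m P`_d != 0.

Lemma top_form1 y : top_form y 1.
Proof.
exists 0%N; split=> [[|k] // _|]; first by rewrite coef1.
rewrite coef1 mulmx1; apply/eqP => /matrixP /(_ 0 1).
by rewrite !mxE.
Qed.

Lemma coef_transvec_top y e (P : {poly 'M[int]_2}) d :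
    (forall k, (d < k)%N -> P`_k = 0) ->
  (transvec y e * P)`_d.+1 = e *: (fvec y *m (fform y *m P`_d)).
Proof.
move=> Pd; rewrite coef_transvec Pd // add0r -scalerAl.
by rewrite -[_ * _]/(_ *m _) mulmxA.
Qed.

(* Each syllable of a reduced word raises the degree by one: the leading
   coefficient of the rest of the word has image spanned by the vector of a
   different generator, on which the form of this one does not vanish. *)
Lemma top_form_transvec y z e P : e != 0 -> z != y ->
  top_form y P -> top_form z (transvec y e * P).
Proof.
move=> e0 zy [d [Pd topP]]; exists d.+1; split=> [[//|k] dk|].
  by rewrite coef_transvec !Pd ?mulr0 ?addr0 //; lia.
rewrite coef_transvec_top // -scalemxAr (mulmxA (fform z)) fform_fvec.
rewrite mul_scalar_mx.
rewrite !scalemx_eq0 (negPf e0) (negPf topP) orbF subr_eq0.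
by rewrite eqz_nat (inj_eq (pcan_inj (@pickleK Y))) eq_sym.
Qed.

Lemma transvec_top_neq1 y e P : e != 0 -> top_form y P -> transvec y e * P != 1.
Proof.
move=> e0 [d [Pd topP]]; apply/eqP => /polyP /(_ d.+1).
rewrite coef_transvec_top // coef1 => /eqP.
rewrite scalemx_eq0 (negPf e0) /= => /eqP vf0; case/eqP: topP.
(* The first entry of [fvec y] is 1, so this row vector cancels it on the left. *)
have e1v : delta_mx 0 0 *m fvec y = 1%:M.
  by rewrite -rowE; apply/matrixP => i j; rewrite !ord1 !mxE.
by rewrite -[LHS]mul1mx -e1v -mulmxA vf0 mulmx0.
Qed.

Definition reduced (w : word Y) := sorted (fun l l' => l' != inv_letter l) w.

Lemma free_reduced (g : free Y) : exists2 w, reduced w & g = pres_pi _ w.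
Proof.
have cons_red l w : reduced w ->
    exists2 w', reduced w' & pres_pi (@no_rel Y) (l :: w) = pres_pi _ w'.
  case: w => [|l' w] red_w; first by exists [:: l].
  have [-> | ll'] := eqVneq l' (inv_letter l).
    exists w; first exact: path_sorted red_w.
    rewrite -[l :: _ :: w]/([:: l; inv_letter l] ++ w) pres_pi_cat.
    rewrite -[RHS]mul1g; congr (_ * _)%g.
    by apply/pres_piP; apply: pres_cancel.
  by exists (l :: l' :: w); rewrite /= ?ll'.
elim/presented_ind: g => [|x g [w red_w ->]|x g [w red_w ->]].
- by exists [::].
- have [w' red_w' e] := cons_red (x, false) w red_w.
  by exists w'; rewrite // -e pres_pi_cons.
have [w' red_w' e] := cons_red (x, true) w red_w.
by exists w'; rewrite // -e pres_pi_cons.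
Qed.

(** The first syllable is collected into one transvection: in a reduced word adjacent letters on the
    same generator have the same sign, so their exponents add without cancelling. [P] is the image
    of the remaining syllables. *)
Lemma magnus_reduced l w : reduced (l :: w) -> exists n P,
  wact transvec_letter (l :: w) 1 =
    transvec l.1 ((if l.2 then -1 else 1) * n.+1%:Z) * P /\ top_form l.1 P.
Proof.
elim: w l => [|l' w IHw] l /=.
  exists 0%N, 1; rewrite /transvec_letter !mulr1.
  by split=> //; apply: top_form1.
case/andP=> ll' red_w; have [n [P [/= eP topP]]] := IHw l' red_w.
have [l1 | l1] := eqVneq l.1 l'.1.
  have l2 : l.2 = l'.2.
    move: ll'; rewrite {1}(surjective_pairing l') /inv_letter -l1 xpair_eqE.
    by rewrite eqxx /=; case: l.2; case: l'.2.
  exists n.+1, P; rewrite eP /transvec_letter.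
  split; last by rewrite l1.
  by rewrite mulrA -l1 transvecD l2; congr (transvec _ _ * _); lia.
exists 0%N, (wact transvec_letter (l' :: w) 1).
rewrite (mulr1 (if _ then _ else _)).
split=> //; rewrite /= eP; apply: top_form_transvec => //.
by case: l'.2.
Qed.

Lemma magnus_inj g : magnus g = 1 -> g = 1%g.
Proof.
have [[|l w] red_w ->] // := free_reduced g.
rewrite magnus_pi; have [n [P [-> topP]]] := magnus_reduced red_w.
by move/eqP; rewrite (negPf (transvec_top_neq1 _ topP)) //; case: l.2.
Qed.

Lemma strongly_indicable_free : strongly_indicable (free Y).
Proof. exact: (strongly_indicable_poly magnusM magnus0 magnus_inj). Qed.

End FreeGroup.

(** * Artin groups of type B *)

(** Associates to the left and cancels adjacent inverses. Most identities below are a relation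
    multiplied on both sides by suitable factors, via [congr1], and then simplified in this way. *)
Ltac free_group_simpl := rewrite ?(mulgA, invgM, invgK, invg1);
  rewrite ?(mulg1, mul1g, mulgV, mulVg, mulgK, mulgVK).

(** * Consequences of the braid relation and of the relation of length four *)

Section BraidRelation.
Variables (G : groupType) (p q t : G).
Hypotheses (pqp : p * q * p = q * p * q) (pt : commute p t).

Lemma braid_conjVJ : p * q^-1 * p^-1 = q^-1 * p^-1 * q.
Proof.
apply: (mulIg p); apply: (mulgI q); free_group_simpl.
by apply: (mulgI p); free_group_simpl; rewrite pqp; free_group_simpl.
Qed.

(** Conjugation by p q takes p to q and t to the element on the right, and p commutes with t. *)
Lemma braid_commute_conj : commute q (p * (q * t * q^-1) * p^-1).
Proof.
rewrite /commute; free_group_simpl.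
rewrite -pqp -(mulgA _ p t) pt -!mulgA; congr (p * (q * (t * _))).
by rewrite !mulgA braid_conjVJ.
Qed.

(** Conjugation by q p takes q to p and, since p commutes with t, takes t to y; it therefore
    transports the relation. *)
Lemma braid_quad_conj : q * t * q * t = t * q * t * q ->
  let y := q * t * q^-1 in p * y * p * y = y * p * y * p.
Proof.
move=> qt; set c := q * p.
have pE : p = c * q * c^-1.
  by rewrite /c -pqp; free_group_simpl.
have yE : q * t * q^-1 = c * t * c^-1.
  by rewrite /c -(mulgA q p t) pt; free_group_simpl.
clearbody c; rewrite yE /= pE; free_group_simpl.
by have := congr1 (fun g => c * g * c^-1) qt; free_group_simpl.
Qed.

End BraidRelation.

(** With p = a_i, y = x_(i+1) and z = x_i this is the nontrivial formula of Artin's automorphism. *)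
Lemma quad_conj (G : groupType) (p y : G) : p * y * p * y = y * p * y * p ->
  let z := p * y * p^-1 in p * z = z^-1 * y * z * p.
Proof.
move=> py z; rewrite {}/z.
have := congr1 (fun g => p * y^-1 * p^-1 * g * p^-1) py.
by free_group_simpl.
Qed.

(** * Presentations of types A and B with generators indexed by natural numbers *)

Section NatGenerators.
Variables (n : nat) (R : word 'I_n -> word 'I_n -> Prop).

(* Junk value: 1 when k >= n; the last generator of type B_(m+1) is thus sent to
   1 in type A_m. *)
Definition ngen (k : nat) : presented R :=
  if insub k is Some i then pgen R i else 1.

Lemma ngen_ord (i : 'I_n) : ngen i = pgen R i.
Proof. by rewrite /ngen valK. Qed.

Lemma ngen_ltn k (kn : k < n) : pgen R (Ordinal kn) = ngen k.
Proof. by rewrite -ngen_ord. Qed.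

Lemma ngen_out k : n <= k -> ngen k = 1.
Proof. by move=> nk; rewrite /ngen insubF // ltnNge nk. Qed.

Lemma ngen_rel2 (i j : 'I_n) :
  R [:: gen i; gen j] [:: gen j; gen i] -> commute (ngen i) (ngen j).
Proof.
by move/pres_rel_eq; rewrite !pres_pi_cons pres_pi_nil -!ngen_ord /= !mulg1.
Qed.

End NatGenerators.

Inductive artinA_rel (n : nat) : word 'I_n -> word 'I_n -> Prop :=
| artinA_comm (i j : 'I_n) : (i.+2 <= j) || (j.+2 <= i) ->
    artinA_rel [:: gen i; gen j] [:: gen j; gen i]
| artinA_braid (i j : 'I_n) : j = i.+1 :> nat ->
    artinA_rel [:: gen i; gen j; gen i] [:: gen j; gen i; gen j].

(* The braid group on n + 1 strands. *)
Definition artinA (n : nat) : groupType := presented (@artinA_rel n).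

Section ArtinA.
Variable n : nat.
Local Notation a := (@ngen n (@artinA_rel n)).

Lemma artinA_ngenC k l : k.+2 <= l -> commute (a k) (a l).
Proof.
move=> kl; have [nl|ln] := leqP n l.
  by rewrite (ngen_out _ nl) /commute mulg1 mul1g.
have kn : k < n by lia.
apply: (ngen_rel2 (i := Ordinal kn) (j := Ordinal ln)).
by apply: artinA_comm; rewrite /= kl.
Qed.

Lemma artinA_ngen_braid k : k.+1 < n ->
  a k * a k.+1 * a k = a k.+1 * a k * a k.+1.
Proof.
move=> ln; have kn : k < n by lia.
pose i := Ordinal kn; pose j := Ordinal ln.
have /pres_rel_eq : artinA_rel [:: gen i; gen j; gen i]
    [:: gen j; gen i; gen j] by apply: artinA_braid.
by rewrite !pres_pi_cons pres_pi_nil -!ngen_ord /= !mulg1 !mulgA.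
Qed.

Lemma artinA_lift (H : groupType) (h : nat -> H) :
    (forall k l, k.+2 <= l < n -> commute (h k) (h l)) ->
    (forall k, k.+1 < n -> h k * h k.+1 * h k = h k.+1 * h k * h k.+1) ->
  exists2 f : artinA n -> H, {morph f : x y / x * y}
    & forall k, k < n -> f (a k) = h k.
Proof.
move=> hC hB; pose h' (i : 'I_n) := h i.
have hR u v : artinA_rel u v ->
    wact (lmul_letter h') u 1 = wact (lmul_letter h') v 1.
  case=> {u v} i j; rewrite /wact /lmul_letter /h' /= !mulg1.
    by case/orP=> ij; [|symmetry]; apply: hC; rewrite ij ltn_ord.
  by move=> ij; have := ltn_ord j; rewrite !mulgA ij => /hB.
exists (lift h'); first exact: liftM.
by move=> k kn; rewrite -[k]/(val (Ordinal kn)) ngen_ord lift_gen.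
Qed.

End ArtinA.

Section ArtinB.
Variable n : nat.
Local Notation b := (@ngen n (@artinB_rel n)).

Lemma artinB_ngenC k l : k.+2 <= l -> commute (b k) (b l).
Proof.
move=> kl; have [nl|ln] := leqP n l.
  by rewrite (ngen_out _ nl) /commute mulg1 mul1g.
have kn : k < n by lia.
apply: (ngen_rel2 (i := Ordinal kn) (j := Ordinal ln)).
by apply: artinB_comm; rewrite /= kl.
Qed.

Lemma artinB_ngen_braid k : k.+2 < n ->
  b k * b k.+1 * b k = b k.+1 * b k * b k.+1.
Proof.
move=> kn2; have kn : k < n by lia. have ln : k.+1 < n by lia.
pose i := Ordinal kn; pose j := Ordinal ln.
have /pres_rel_eq : artinB_rel [:: gen i; gen j; gen i]
    [:: gen j; gen i; gen j] by apply: artinB_braid.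
by rewrite !pres_pi_cons pres_pi_nil -!ngen_ord /= !mulg1 !mulgA.
Qed.

Lemma artinB_ngen_last k : k.+2 = n ->
  b k * b k.+1 * b k * b k.+1 = b k.+1 * b k * b k.+1 * b k.
Proof.
move=> kn2; have kn : k < n by lia. have ln : k.+1 < n by lia.
pose i := Ordinal kn; pose j := Ordinal ln.
have /pres_rel_eq : artinB_rel [:: gen i; gen j; gen i; gen j]
    [:: gen j; gen i; gen j; gen i] by apply: artinB_last.
by rewrite !pres_pi_cons pres_pi_nil -!ngen_ord /= !mulg1 !mulgA.
Qed.

Lemma artinB_lift (H : groupType) (h : nat -> H) :
    (forall k l, k.+2 <= l < n -> commute (h k) (h l)) ->
    (forall k, k.+2 < n -> h k * h k.+1 * h k = h k.+1 * h k * h k.+1) ->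
    (forall k, k.+2 = n ->
      h k * h k.+1 * h k * h k.+1 = h k.+1 * h k * h k.+1 * h k) ->
  exists2 f : artinB n -> H, {morph f : x y / x * y}
    & forall k, k < n -> f (b k) = h k.
Proof.
move=> hC hB hL; pose h' (i : 'I_n) := h i.
have hR u v : artinB_rel u v ->
    wact (lmul_letter h') u 1 = wact (lmul_letter h') v 1.
  case=> {u v} i j; rewrite /wact /lmul_letter /h' /= !mulg1.
  - by case/orP=> ij; [|symmetry]; apply: hC; rewrite ij ltn_ord.
  - by move=> ij; rewrite !mulgA ij => /hB.
  - by move=> ij; rewrite !mulgA ij => /hL.
exists (lift h'); first exact: liftM.
by move=> k kn; rewrite -[k]/(val (Ordinal kn)) ngen_ord lift_gen.
Qed.

End ArtinB.

Section FreeNat.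
Variable n : nat.
Local Notation F := (free 'I_n).
Local Notation x := (@ngen n (@no_rel 'I_n)).

Lemma flift_ngen (H : groupType) (h : 'I_n -> H) k (kn : k < n) :
  flift h (x k) = h (Ordinal kn).
Proof. by rewrite -[k]/(val (Ordinal kn)) ngen_ord flift_gen. Qed.

Lemma free_nat_lift (H : groupType) (h : nat -> H) :
  exists2 f : F -> H, {morph f : u v / u * v}
    & forall k, k < n -> f (x k) = h k.
Proof.
exists (flift (fun i : 'I_n => h i)); first exact: fliftM.
by move=> k kn; rewrite flift_ngen.
Qed.

End FreeNat.

Lemma nat_morph_ext n R (H : groupType) (f f' : @presented 'I_n R -> H) :
    {morph f : u v / u * v} -> {morph f' : u v / u * v} ->
  (forall k, k < n -> f (ngen R k) = f' (ngen R k)) -> f =1 f'.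
Proof.
move=> fM f'M ff'; apply: presented_morph_ext => // i.
by rewrite -ngen_ord ff'.
Qed.

(* The free factor is generated by the conjugates x_k = a_k x_(k+1) a_k^-1 of
   x_m = a_m, where m + 1 is the number of generators; a_i with i < m acts on
   it by Artin's automorphism [artin_aut i]. *)
Section SplitB.
Variable m : nat.
Local Notation F := (free 'I_m.+1).
Local Notation G := (artinB m.+1).
Local Notation x := (@ngen m.+1 (@no_rel 'I_m.+1)).
Local Notation b := (@ngen m.+1 (@artinB_rel m.+1)).

(** The index i = m gives the identity, because the last generator has trivial image in the braid
    group. *)
Definition artin_aut (i : nat) : F -> F := flift (fun j : 'I_m.+1 =>
  if i < m then
    if j == i :> nat then (x i)^-1 * x i.+1 * x i
    else if j == i.+1 :> nat then x i else x j
  else x j).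

Definition artin_autV (i : nat) : F -> F := flift (fun j : 'I_m.+1 =>
  if i < m then
    if j == i :> nat then x i.+1
    else if j == i.+1 :> nat then x i.+1 * x i * (x i.+1)^-1 else x j
  else x j).

Lemma artin_autM i : {morph artin_aut i : u v / u * v}.
Proof. exact: fliftM. Qed.

Lemma artin_autVM i : {morph artin_autV i : u v / u * v}.
Proof. exact: fliftM. Qed.

Lemma artin_aut_id i : i < m -> artin_aut i (x i) = (x i)^-1 * x i.+1 * x i.
Proof.
move=> im; have im1 : i < m.+1 by lia.
by rewrite /artin_aut flift_ngen im /= eqxx.
Qed.

Lemma artin_aut_succ i : i < m -> artin_aut i (x i.+1) = x i.
Proof.
move=> im; have im1 : i.+1 < m.+1 by lia.
rewrite /artin_aut flift_ngen im /= eqxx.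
by rewrite ifN //; lia.
Qed.

Lemma artin_aut_ne i j : j != i -> j != i.+1 -> artin_aut i (x j) = x j.
Proof.
move=> ji ji1; have [mj|jm] := leqP m.+1 j.
  by rewrite ngen_out // (morph1 (@artin_autM i)).
rewrite /artin_aut flift_ngen /=.
by rewrite (negPf ji) (negPf ji1) if_same.
Qed.

Lemma artin_aut_triv i u : m <= i -> artin_aut i u = u.
Proof.
move=> mi; apply: (nat_morph_ext (@artin_autM i) (f' := id)) => // k km.
rewrite /artin_aut flift_ngen /=.
by rewrite ltnNge mi.
Qed.

Lemma artin_autV_id i : i < m -> artin_autV i (x i) = x i.+1.
Proof.
move=> im; have im1 : i < m.+1 by lia.
by rewrite /artin_autV flift_ngen im /= eqxx.
Qed.

Lemma artin_autV_succ i : i < m ->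
  artin_autV i (x i.+1) = x i.+1 * x i * (x i.+1)^-1.
Proof.
move=> im; have im1 : i.+1 < m.+1 by lia.
rewrite /artin_autV flift_ngen im /= eqxx.
by rewrite ifN //; lia.
Qed.

Lemma artin_autV_ne i j : j != i -> j != i.+1 -> artin_autV i (x j) = x j.
Proof.
move=> ji ji1; have [mj|jm] := leqP m.+1 j.
  by rewrite ngen_out // (morph1 (@artin_autVM i)).
rewrite /artin_autV flift_ngen /=.
by rewrite (negPf ji) (negPf ji1) if_same.
Qed.

Lemma artin_autV_triv i u : m <= i -> artin_autV i u = u.
Proof.
move=> mi; apply: (nat_morph_ext (@artin_autVM i) (f' := id)) => // k km.
rewrite /artin_autV flift_ngen /=.
by rewrite ltnNge mi.
Qed.

Lemma artin_autK i : cancel (artin_aut i) (artin_autV i).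
Proof.
move=> u; have [mi|im] := leqP m i.
  by rewrite artin_aut_triv ?artin_autV_triv.
apply: (nat_morph_ext (f := artin_autV i \o artin_aut i) (f' := id)) => //.
  by move=> v w /=; rewrite artin_autM artin_autVM.
move=> k _ /=.
have [->|ki] := eqVneq k i.
  rewrite artin_aut_id // !artin_autVM (morphV (@artin_autVM i)).
  by rewrite artin_autV_id // artin_autV_succ //; free_group_simpl.
have [->|ki1] := eqVneq k i.+1.
  by rewrite artin_aut_succ // artin_autV_id.
by rewrite artin_aut_ne // artin_autV_ne.
Qed.

Lemma artin_autVK i : cancel (artin_autV i) (artin_aut i).
Proof.
move=> u; have [mi|im] := leqP m i.
  by rewrite artin_autV_triv ?artin_aut_triv.
apply: (nat_morph_ext (f := artin_aut i \o artin_autV i) (f' := id)) => //.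
  by move=> v w /=; rewrite artin_autVM artin_autM.
move=> k _ /=.
have [->|ki] := eqVneq k i; first by rewrite artin_autV_id // artin_aut_succ.
have [->|ki1] := eqVneq k i.+1.
  rewrite artin_autV_succ // !artin_autM (morphV (@artin_autM i)).
  by rewrite artin_aut_succ // artin_aut_id //; free_group_simpl.
by rewrite artin_autV_ne // artin_aut_ne.
Qed.

Lemma artin_autC i j u : i.+2 <= j ->
  artin_aut i (artin_aut j u) = artin_aut j (artin_aut i u).
Proof.
move=> ij; have [mj|jm] := leqP m j; first by rewrite !(artin_aut_triv _ mj).
apply: (nat_morph_ext (f := artin_aut i \o artin_aut j)
  (f' := artin_aut j \o artin_aut i)) => [v w|v w|k _] /=.
- by rewrite !artin_autM.
- by rewrite !artin_autM.
have im : i < m by lia.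
have aut_i l : (l == j) || (l == j.+1) -> artin_aut i (x l) = x l.
  by move=> ?; apply: artin_aut_ne; lia.
have aut_j l : (l == i) || (l == i.+1) -> artin_aut j (x l) = x l.
  by move=> ?; apply: artin_aut_ne; lia.
have [->|ki] := eqVneq k i.
  rewrite aut_j ?eqxx // artin_aut_id // !artin_autM.
  by rewrite (morphV (@artin_autM j)) !aut_j ?eqxx ?orbT.
have [->|ki1] := eqVneq k i.+1.
  by rewrite aut_j ?eqxx ?orbT // artin_aut_succ // aut_j ?eqxx.
have [->|kj] := eqVneq k j.
  rewrite aut_i ?eqxx // artin_aut_id // !artin_autM.
  by rewrite (morphV (@artin_autM i)) !aut_i ?eqxx ?orbT.
have [->|kj1] := eqVneq k j.+1.
  by rewrite aut_i ?eqxx ?orbT // artin_aut_succ // aut_i ?eqxx.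
by rewrite artin_aut_ne // !(artin_aut_ne ki) // artin_aut_ne.
Qed.

Lemma artin_aut_braid i u : i.+1 < m ->
  artin_aut i (artin_aut i.+1 (artin_aut i u)) =
  artin_aut i.+1 (artin_aut i (artin_aut i.+1 u)).
Proof.
move=> im1; have im : i < m by lia.
apply: (nat_morph_ext (f := artin_aut i \o (artin_aut i.+1 \o artin_aut i))
  (f' := artin_aut i.+1 \o (artin_aut i \o artin_aut i.+1)))
  => [v w|v w|k _] /=.
- by rewrite !artin_autM.
- by rewrite !artin_autM.
have aut_i2 : artin_aut i (x i.+2) = x i.+2 by apply: artin_aut_ne; lia.
have aut_1i : artin_aut i.+1 (x i) = x i by apply: artin_aut_ne; lia.
have autE := (artin_autM, morphV (@artin_autM _), aut_i2, aut_1i,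
  artin_aut_id im, artin_aut_id im1,
  artin_aut_succ im, artin_aut_succ im1).
have [->|ki] := eqVneq k i; first by rewrite !autE; free_group_simpl.
have [->|ki1] := eqVneq k i.+1; first by rewrite !autE; free_group_simpl.
have [->|ki2] := eqVneq k i.+2; first by rewrite !autE; free_group_simpl.
by rewrite !(artin_aut_ne ki ki1, artin_aut_ne ki1 ki2).
Qed.


(** The argument is the distance m - k from the top index, since x_k is defined from x_(k+1). *)
Fixpoint xB_from_top (d : nat) : G :=
  if d is d'.+1 then b (m - d) * xB_from_top d' * (b (m - d))^-1 else b m.

Definition xB (k : nat) : G := xB_from_top (m - k).

Lemma xB_last : xB m = b m.
Proof. by rewrite /xB subnn. Qed.

Lemma xB_step k : k < m -> xB k = b k * xB k.+1 * (b k)^-1.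
Proof.
by move=> km; rewrite /xB -(subnSK km) /= subnSK // subKn // ltnW.
Qed.

Lemma down_ind (P : nat -> Prop) :
  P m -> (forall k, k < m -> P k.+1 -> P k) -> forall k, k <= m -> P k.
Proof.
move=> Pm Pstep k km; rewrite -(subKn km).
elim: (m - k) (leq_subr k m) => [|d IHd] dm; first by rewrite subn0.
by apply: Pstep; rewrite ?subnSK //; [lia | apply: IHd; lia].
Qed.

(** x_k is a word in a_k, ..., a_m, all of which commute with a_i. *)
Lemma xB_comm_above i k : i.+1 < k <= m -> commute (b i) (xB k).
Proof.
case/andP=> + km; elim/down_ind: k / km => [|k km IHk] ik.
  by rewrite xB_last; apply: artinB_ngenC.
rewrite xB_step //; have bC : commute (b i) (b k) by apply: artinB_ngenC.
by apply: commuteM; [apply: commuteM => //; apply: IHk; lia | apply: commuteV].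
Qed.

(** For k = i - 1, x_k is the conjugate of x_(i+1) by a_(i-1) a_i and [braid_commute_conj] applies.
    For smaller k, a_i commutes with both a_k and x_(k+1). *)
Lemma xB_comm_below i k : k < i < m -> commute (b i) (xB k).
Proof.
case/andP=> ki im; have km : k <= m by lia.
elim/down_ind: k / km ki => [|k km IHk] ki; first by lia.
have [<-|k1i] := eqVneq k.+1 i.
  have bX : commute (b k) (xB k.+2) by apply: xB_comm_above; lia.
  rewrite xB_step // xB_step; last by lia.
  by apply: braid_commute_conj => //; apply: artinB_ngen_braid; lia.
rewrite xB_step //; have bC : commute (b i) (b k).
  by symmetry; apply: artinB_ngenC; lia.
by apply: commuteM; [apply: commuteM => //; apply: IHk; lia | apply: commuteV].
Qed.

(** Downward induction from the defining relation between a_(m-1) and x_m = a_m; [braid_quad_conj]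
    lowers the index by one. *)
Lemma xB_quad i : i < m ->
  b i * xB i.+1 * b i * xB i.+1 = xB i.+1 * b i * xB i.+1 * b i.
Proof.
move=> im; suff quad k : k <= m -> forall j, j.+1 = k ->
    b j * xB j.+1 * b j * xB j.+1 = xB j.+1 * b j * xB j.+1 * b j.
  exact: quad im _ erefl.
move=> km; elim/down_ind: k / km => [j jm|k km IHk j jk].
  by rewrite jm xB_last -jm; apply: artinB_ngen_last.
rewrite -jk in km IHk *; rewrite xB_step //; apply: braid_quad_conj.
- by apply: artinB_ngen_braid; lia.
- by apply: xB_comm_above; lia.
- exact: IHk.
Qed.


Lemma xB_conj iota i j : {morph iota : u v / u * v} ->
    (forall k, k < m.+1 -> iota (x k) = xB k) -> i < m -> j <= m ->
  b i * xB j = iota (artin_aut i (x j)) * b i.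
Proof.
move=> iM ix im jm.
have [->|ji] := eqVneq j i.
  rewrite artin_aut_id // !iM (morphV iM) !ix; try by lia.
  by rewrite (xB_step im) (quad_conj (xB_quad im)).
have [->|ji1] := eqVneq j i.+1.
  by rewrite artin_aut_succ // ix ?(xB_step im) ?mulgVK //; lia.
rewrite artin_aut_ne // ix //; have [ij|ij] := ltnP i j.
  by apply: xB_comm_above; lia.
by apply: xB_comm_below; lia.
Qed.

Definition affB (i : 'I_m.+1) : F := if i == m :> nat then x m else 1.

Local Notation actB :=
  (aff_letter affB (fun i : 'I_m.+1 => artin_aut i)
    (fun i : 'I_m.+1 => artin_autV i)).

Lemma affB_rel u v : artinB_rel u v -> wact actB u =1 wact actB v.
Proof.
case=> {u v} i j; rewrite /wact /= /aff_letter /affB /=.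
- wlog ij : i j / i.+2 <= j.
    move=> wl /orP[ij|ji] w; first by apply: wl; rewrite ?ij.
    by symmetry; apply: wl; rewrite ?ji.
  move=> _ w; have jm := ltn_ord j.
  have /negPf -> : i != m :> nat by lia.
  rewrite !mul1g artin_autM artin_autC //; congr (_ * _).
  have [_|_] := eqVneq (j : nat) m; last by rewrite (morph1 (@artin_autM _)).
  by rewrite artin_aut_ne //; lia.
- move=> ij jm w; have /negPf -> : i != m :> nat by lia.
  have /negPf -> : j != m :> nat by lia.
  rewrite !mul1g ij.
  by rewrite artin_aut_braid //; lia.
(* With al = [artin_aut i] and i = m - 1, both sides send w to x_m x_i al(al(w)). *)
move=> ij jm w; have jE : j = m :> nat by lia.
have im : i < m by lia. have i1m : m = i.+1 by lia.
rewrite jE eqxx ifN ?mul1g; last by lia.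
rewrite !(artin_aut_triv _ (leqnn m)) !artin_autM.
have -> : artin_aut i (x m) = x i by have := artin_aut_succ im; rewrite -i1m.
by rewrite (artin_aut_id im) -i1m !mulgA mulgV mul1g.
Qed.

(** The map [f] kills the last generator, [s] is the obvious section, and the kernel is free on the
    x_k. *)
Lemma strongly_indicable_artinB :
  strongly_indicable (artinA m) -> strongly_indicable G.
Proof.
have [f fM fE] : exists2 f : G -> artinA m, {morph f : u v / u * v}
    & forall k, k < m.+1 -> f (b k) = ngen (@artinA_rel m) k.
  apply: artinB_lift => [k l /andP[kl _] | k km | k km].
  - exact: artinA_ngenC.
  - exact: artinA_ngen_braid.
  - by rewrite [ngen _ k.+1]ngen_out; [rewrite !mulg1 mul1g | lia].
have [s sM sE] : exists2 s : artinA m -> G, {morph s : u v / u * v}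
    & forall k, k < m -> s (ngen (@artinA_rel m) k) = b k.
  apply: artinA_lift => [k l /andP[kl _] | k km].
    exact: artinB_ngenC.
  exact: artinB_ngen_braid.
have [iota iM iE] := free_nat_lift m.+1 xB.
have sfE i : i < m -> s (f (b i)) = b i by move=> im; rewrite fE ?sE //; lia.
have sfm : s (f (b m)) = 1 by rewrite fE // ngen_out // (morph1 sM).
have actK := aff_letterK (X := 'I_m.+1) affB
  (fun i => @artin_autK i) (fun i => @artin_autVK i).
move=> siA; move: siA (@strongly_indicable_free 'I_m.+1).
apply: (strongly_indicable_split (f := f) (s := s) (iota := iota)
  (k := affB) (al := fun i : 'I_m.+1 => artin_aut i)
  (be := fun i : 'I_m.+1 => artin_autV i)) => //.
- by move=> i; apply: artin_autK.
- by move=> i; apply: artin_autVK.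
- exact: affB_rel.
- move=> i; rewrite -ngen_ord /affB; case: eqP => [->|im].
    by rewrite sfm mulg1 iE // xB_last.
  by rewrite (morph1 iM) mul1g sfE //; have := ltn_ord i; lia.
- move=> i w; rewrite -ngen_ord.
  have [mi|im] := leqP m i.
    have -> : i = m :> nat by have := ltn_ord i; lia.
    by rewrite sfm artin_aut_triv // mulg1 mul1g.
  rewrite sfE //; apply: (mulIg (b i)^-1); rewrite mulgK.
  apply: (nat_morph_ext (f := fun w => b i * iota w * (b i)^-1)
    (f' := fun w => iota (artin_aut i w))) => [u v|u v|k km].
  - by rewrite iM; free_group_simpl.
  - by rewrite artin_autM iM.
  - by rewrite iE // (xB_conj iM iE) // mulgK.
move=> i w; rewrite /fgen -ngen_ord iE //.
have im : i <= m by have := ltn_ord i; lia.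
have actM := pactM actK affB_rel.
(* x_m = a_m acts by left translation. The translation by x_(k+1), conjugated by the automorphism
   [artin_aut k], which sends x_(k+1) to x_k, is the translation by x_k. *)
elim/down_ind: (i : nat) / im w => [|k km IHk] w.
  rewrite xB_last -[m]/(val (ord_max : 'I_m.+1)) [b _]ngen_ord.
  rewrite (pact_gen actK affB_rel) /aff_letter /affB /= eqxx.
  by rewrite artin_aut_triv.
have km1 : k < m.+1 by lia.
rewrite xB_step // !actM -[k in b k]/(val (Ordinal km1)) !ngen_ord.
rewrite (pact_gen actK affB_rel) (pact_genV actK affB_rel) /aff_letter /affB /=.
rewrite (ltn_eqF km) invg1 !mul1g IHk artin_autM artin_autVK artin_aut_succ //.
Qed.

End SplitB.

(** * Braid groups on at most four strands *)

Section BraidIdentities.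
Variables (G : groupType) (a b c : G).
Hypothesis aba : a * b * a = b * a * b.

Lemma braid_conj_quot :
  a * (a * (b * a^-1) * a^-1) * a^-1 = (b * a^-1)^-1 * (a * (b * a^-1) * a^-1).
Proof.
have := congr1 (fun g => a * b^-1 * g * a^-1 * a^-1 * a^-1) aba.
by free_group_simpl => <-.
Qed.

Hypotheses (ac : commute a c) (bcb : b * c * b = c * b * c).
Let u := c * a^-1.
Let v := b * u * b^-1.

Lemma a_conj_v : a * v * a^-1 = u^-1 * v.
Proof.
transitivity (a * b * c * b^-1 * a^-1 * b^-1).
  have := congr1 (fun g => a * b * c * g^-1) aba.
  by rewrite /v /u; free_group_simpl => ->.
have := congr1 (fun g => a * c^-1 * g * b^-1 * a^-1 * b^-1) bcb.
by rewrite /v /u; free_group_simpl => <-.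
Qed.

Lemma b_conj_v : b * v * b^-1 = v * u^-1 * v.
Proof.
have a'b'a : a^-1 * b^-1 * a = b * a^-1 * b^-1.
  by have := congr1 (fun g => b * g^-1 * a) aba; free_group_simpl => ->.
have c'bc : c^-1 * b * c = b * c * b^-1.
  by have := congr1 (fun g => c^-1 * g * b^-1) bcb; free_group_simpl => ->.
have a'c : a^-1 * c = c * a^-1 by apply/commute_sym/commuteV/commute_sym.
(* This is v u^-1 v written in a, b, c and grouped so that a braid relation rewrites each inner
   conjugate. *)
transitivity (b * (c * (a^-1 * b^-1 * a) * (c^-1 * b * c) * a^-1) * b^-1).
  rewrite a'b'a c'bc /v /u; free_group_simpl.
  rewrite -(mulgA _ a^-1 c) a'c; free_group_simpl.
  have := congr1 (fun g => b * b * c * b * g^-1 * b^-1) aba.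
  have := congr1 (fun g => b * g * a^-1 * b^-1 * a^-1 * b^-1) bcb.
  by free_group_simpl => <- ->.
by rewrite /v /u; free_group_simpl.
Qed.


End BraidIdentities.

(** This group is free of rank 1. The isomorphism has trivial kernel, so a constant map serves as
    the embedding of the kernel. *)
Lemma strongly_indicable_artinA1 : strongly_indicable (artinA 1).
Proof.
have [f fM fE] : exists2 f : artinA 1 -> free 'I_1, {morph f : u v / u * v}
    & forall k, k < 1 -> f (ngen (@artinA_rel 1) k) = ngen (@no_rel 'I_1) k.
  by apply: artinA_lift => k; lia.
have [g gM gE] := free_nat_lift 1 (ngen (@artinA_rel 1)).
have fK : cancel f g.
  apply: (nat_morph_ext (f := g \o f) (f' := id)) => // [u v|k k1] /=.
    by rewrite fM gM.
  by rewrite fE // gE.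
apply: (@strongly_indicable_ext _ _ (free 'I_1) f (fun _ => 1)) => //.
- by move=> u v _ _; rewrite mulg1.
- by move=> u fu _; rewrite -(fK u) fu (morph1 gM).
- exact: strongly_indicable_free.
- exact: strongly_indicable_free.
Qed.

Section FreeRank2.
Local Notation F := (free 'I_2).
Local Notation u := (ngen (@no_rel 'I_2) 0).
Local Notation v := (ngen (@no_rel 'I_2) 1).

Definition flift2 (H : groupType) (p q : H) : F -> H :=
  flift (fun i : 'I_2 => if i == 0 :> nat then p else q).

Lemma flift2M (H : groupType) (p q : H) :
  {morph flift2 p q : g h / g * h}.
Proof. exact: fliftM. Qed.

Lemma flift2u (H : groupType) (p q : H) : flift2 p q u = p.
Proof. by rewrite /flift2 flift_ngen. Qed.

Lemma flift2v (H : groupType) (p q : H) : flift2 p q v = q.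
Proof. by rewrite /flift2 flift_ngen. Qed.

Definition flift2E := (flift2u, flift2v, fun H p q => @flift2M H p q,
  fun H p q => morphV (@flift2M H p q)).

Lemma free2_ext (H : groupType) (f f' : F -> H) :
    {morph f : g h / g * h} -> {morph f' : g h / g * h} ->
  f u = f' u -> f v = f' v -> f =1 f'.
Proof. by move=> fM f'M fu fv; apply: nat_morph_ext => // -[|[|]]. Qed.

Lemma free2_id (f : F -> F) :
  {morph f : g h / g * h} -> f u = u -> f v = v -> f =1 id.
Proof. by move=> fM fu fv; apply: free2_ext. Qed.

End FreeRank2.

(* The kernel of the exponent sum is free on u = b a^-1 and v = a u a^-1. *)
Section SplitA2.
Local Notation F := (free 'I_2).
Local Notation u := (ngen (@no_rel 'I_2) 0).
Local Notation v := (ngen (@no_rel 'I_2) 1).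
Local Notation G := (artinA 2).
Local Notation a := (ngen (@artinA_rel 2) 0).
Local Notation b := (ngen (@artinA_rel 2) 1).

(** Conjugation by a on the kernel, as computed in [braid_conj_quot]. Both generators use it, since
    a and b = u a have the same image in Z. *)
Let al := flift2 v (u^-1 * v).
Let be := flift2 (u * v^-1) u.

Let alM : {morph al : g h / g * h}. Proof. exact: flift2M. Qed.

Let alK : cancel al be.
Proof.
apply: (@free2_id (be \o al)) => [g h| |]; rewrite /= /al /be !flift2E //.
by free_group_simpl.
Qed.

Let beK : cancel be al.
Proof.
apply: (@free2_id (al \o be)) => [g h| |]; rewrite /= /al /be !flift2E //.
by free_group_simpl.
Qed.

Let kA (i : 'I_2) : F := if i == 0 :> nat then 1 else u.

Local Notation act := (aff_letter kA (fun=> al) (fun=> be)).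

Let affR w w' : artinA_rel w w' -> wact act w =1 wact act w'.
Proof.
case=> {w w'} -[[|[|//]] i2] [[|[|//]] j2] //= _ w.
rewrite /wact /= /aff_letter /kA /= !mul1g /al !flift2E -!mulgA.
by rewrite mulVKg.
Qed.

Lemma strongly_indicable_artinA2 : strongly_indicable G.
Proof.
have [f fM fE] : exists2 f : G -> artinA 1, {morph f : g h / g * h}
    & forall k, k < 2 -> f (ngen (@artinA_rel 2) k) = ngen (@artinA_rel 1) 0.
  by apply: artinA_lift => // k l; lia.
have [s sM sE] : exists2 s : artinA 1 -> G, {morph s : g h / g * h}
    & forall k, k < 1 -> s (ngen (@artinA_rel 1) k) = a.
  by apply: artinA_lift => // k l; lia.
pose iota : F -> G := flift2 (b * a^-1) (a * (b * a^-1) * a^-1).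
have iM : {morph iota : g h / g * h} by apply: flift2M.
have actK := aff_letterK kA (fun=> alK) (fun=> beK).
have actM := pactM actK affR.
have bab : a * b * a = b * a * b by apply: artinA_ngen_braid.
move: strongly_indicable_artinA1 (@strongly_indicable_free 'I_2).
apply: (strongly_indicable_split (f := f) (s := s) (iota := iota)
  (k := kA) (al := fun=> al) (be := fun=> be)) => //.
- case=> [[|[|//]] i2]; rewrite ngen_ltn fE // sE // /kA /= /iota.
    by rewrite (morph1 (@flift2M _ _ _)) mul1g.
  by rewrite !flift2E mulgVK.
- move=> i w; have -> : s (f (pgen _ i)) = a by rewrite -ngen_ord fE ?sE.
  apply: (mulIg a^-1); rewrite mulgK.
  apply: (free2_ext (f := fun w => a * iota w * a^-1)
    (f' := fun w => iota (al w))) => [g h|g h| |].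
  - by rewrite iM !mulgA mulgVK.
  - by rewrite alM iM.
  - by rewrite /iota /al !flift2E.
  - by rewrite /iota /al !flift2E (braid_conj_quot bab).
- case=> [[|[|//]] i2] w; rewrite /fgen ngen_ltn /iota !flift2E.
    rewrite actM -(ngen_ltn _ (isT : 0 < 2)) -(ngen_ltn _ (isT : 1 < 2)).
    rewrite (pact_gen actK affR) (pact_genV actK affR) /aff_letter /kA /=.
    by rewrite invg1 mul1g beK.
  rewrite !actM -(ngen_ltn _ (isT : 0 < 2)) -(ngen_ltn _ (isT : 1 < 2)).
  rewrite !(pact_gen actK affR) !(pact_genV actK affR) /aff_letter /kA /=.
  by rewrite invg1 !mul1g beK alM beK /al /= flift2u.
Qed.

End SplitA2.

(* The kernel of a, b, c |-> a, b, a is free on u = c a^-1 and v = b u b^-1. *)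
Section SplitA3.
Local Notation F := (free 'I_2).
Local Notation u := (ngen (@no_rel 'I_2) 0).
Local Notation v := (ngen (@no_rel 'I_2) 1).
Local Notation G := (artinA 3).
Local Notation a := (ngen (@artinA_rel 3) 0).
Local Notation b := (ngen (@artinA_rel 3) 1).
Local Notation c := (ngen (@artinA_rel 3) 2).

(** Index 1 is conjugation by b; indices 0 and 2 share conjugation by a, since c = u a has the same
    image as a. *)
Let al (i : 'I_3) := if i == 1%N :> nat then flift2 v (v * u^-1 * v)
  else flift2 u (u^-1 * v).
Let be (i : 'I_3) := if i == 1%N :> nat then flift2 (u * v^-1 * u) u
  else flift2 u (u * v).

Let alM i : {morph al i : g h / g * h}.
Proof. by rewrite /al; case: eqP => _; apply: flift2M. Qed.

Let beM i : {morph be i : g h / g * h}.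
Proof. by rewrite /be; case: eqP => _; apply: flift2M. Qed.

Let alK i : cancel (al i) (be i).
Proof.
apply: (@free2_id (be i \o al i)) => [g h| |] /=; first by rewrite alM beM.
  by rewrite /al /be; case: eqP => _; rewrite !flift2E.
rewrite /al /be; case: eqP => _; rewrite !flift2E; last by rewrite mulKg.
by free_group_simpl.
Qed.

Let beK i : cancel (be i) (al i).
Proof.
apply: (@free2_id (al i \o be i)) => [g h| |] /=; first by rewrite beM alM.
  rewrite /al /be; case: eqP => _; rewrite !flift2E //.
  by free_group_simpl.
by rewrite /al /be; case: eqP => _; rewrite !flift2E // mulVKg.
Qed.

Let kA (i : 'I_3) : F := if i == 2 :> nat then u else 1.

Local Notation act := (aff_letter kA al be).

Let al_braid (i j : 'I_3) w : i == 1%N :> nat -> j != 1%N :> nat ->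
  al i (al j (al i w)) = al j (al i (al j w)).
Proof.
rewrite /al => -> /negPf ->.
apply: (free2_ext (f := flift2 _ _ \o (flift2 _ _ \o flift2 _ _))
  (f' := flift2 _ _ \o (flift2 _ _ \o flift2 _ _))) => [g h|g h| |] /=;
  rewrite !flift2E //; free_group_simpl; by [].
Qed.

Let affR w w' : artinA_rel w w' -> wact act w =1 wact act w'.
Proof.
case=> {w w'} -[[|[|[|//]]] i3] [[|[|[|//]]] j3] //= _ w;
  rewrite /wact /= /aff_letter /kA /= !mul1g.
- by rewrite alM /al /= flift2u.
- by rewrite alM /al /= flift2u.
- by symmetry; apply: al_braid.
by rewrite !alM al_braid // /al /= !flift2E !mulgA mulgV mul1g.
Qed.

Lemma strongly_indicable_artinA3 : strongly_indicable G.
Proof.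
(* The boolean is read as an index: a and c go to generator 0, b to generator 1. *)
pose q k := ngen (@artinA_rel 2) (k == 1%N).
have q_braid : q 0 * q 1%N * q 0 = q 1%N * q 0 * q 1%N.
  exact: artinA_ngen_braid.
have [f fM fE] : exists2 f : G -> artinA 2, {morph f : g h / g * h}
    & forall k, k < 3 -> f (ngen (@artinA_rel 3) k) = q k.
  apply: artinA_lift => [k l kl|k k3].
    by have [-> ->] : k = 0 /\ l = 2 by lia.
  have [->|->] : k = 0 \/ k = 1%N by lia.
    exact: q_braid.
  exact: (esym q_braid).
have [s sM sE] : exists2 s : artinA 2 -> G, {morph s : g h / g * h}
    & forall k, k < 2 -> s (ngen (@artinA_rel 2) k) = ngen (@artinA_rel 3) k.
  apply: artinA_lift => [k l|k k2]; first lia.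
  by apply: artinA_ngen_braid; lia.
pose iota : F -> G := flift2 (c * a^-1) (b * (c * a^-1) * b^-1).
have iM : {morph iota : g h / g * h} by apply: flift2M.
have actK := aff_letterK kA alK beK.
have actM := pactM actK affR.
have aba : a * b * a = b * a * b by apply: artinA_ngen_braid.
have bcb : b * c * b = c * b * c by apply: artinA_ngen_braid.
have ac : commute a c by apply: artinA_ngenC.
move: strongly_indicable_artinA2 (@strongly_indicable_free 'I_2).
apply: (strongly_indicable_split (f := f) (s := s) (iota := iota)
  (k := kA) (al := al) (be := be)) => //.
- case=> [[|[|[|//]]] i3]; rewrite ngen_ltn fE // sE // /kA /= /iota.
  + by rewrite (morph1 (@flift2M _ _ _)) mul1g.
  + by rewrite (morph1 (@flift2M _ _ _)) mul1g.
  + by rewrite !flift2E mulgVK.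
- move=> i w.
  have [i1|i1] := eqVneq (i : nat) 1%N.
    have -> : s (f (pgen _ i)) = b by rewrite -ngen_ord fE // i1 sE.
    apply: (mulIg b^-1); rewrite mulgK.
    apply: (free2_ext (f := fun w => b * iota w * b^-1)
      (f' := fun w => iota (al i w))) => [g h|g h| |].
    + by rewrite iM !mulgA mulgVK.
    + by rewrite alM iM.
    + by rewrite /iota /al i1 /= !flift2E.
    + by rewrite /iota /al i1 /= !flift2E (b_conj_v aba ac bcb).
  have -> : s (f (pgen _ i)) = a.
    by rewrite -ngen_ord fE // /q (negPf i1) sE.
  apply: (mulIg a^-1); rewrite mulgK.
  apply: (free2_ext (f := fun w => a * iota w * a^-1)
    (f' := fun w => iota (al i w))) => [g h|g h| |].
  + by rewrite iM !mulgA mulgVK.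
  + by rewrite alM iM.
  + by rewrite /iota /al (negPf i1) !flift2E mulgA ac mulgK.
  + by rewrite /iota /al (negPf i1) !flift2E (a_conj_v aba bcb).
- case=> [[|[|//]] i2] w; rewrite /fgen ngen_ltn /iota !flift2E.
    rewrite actM -(ngen_ltn _ (isT : 0 < 3)) -(ngen_ltn _ (isT : 2 < 3)).
    rewrite (pact_gen actK affR) (pact_genV actK affR) /aff_letter /kA /=.
    by rewrite invg1 mul1g beK.
  rewrite !actM -(ngen_ltn _ (isT : 0 < 3))
    -(ngen_ltn _ (isT : 1 < 3)) -(ngen_ltn _ (isT : 2 < 3)).
  rewrite !(pact_gen actK affR) !(pact_genV actK affR) /aff_letter /kA /=.
  rewrite invg1 !mul1g.
  (* The automorphisms attached to a and c coincide, so the inverse of one cancels the other. *)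
  rewrite -[be (Ordinal (isT : 0 < 3))]/(be (Ordinal (isT : 2 < 3))).
  by rewrite beK alM beK /al /= flift2u.
Qed.

End SplitA3.

(** * Five strands *)

Lemma braid_conj_sym (G : groupType) (p q : G) :
  p * q * p = q * p * q -> q * p * q^-1 = p^-1 * q * p.
Proof.
move=> pqp; have := congr1 (fun g => p^-1 * g * q^-1) pqp.
by free_group_simpl => <-.
Qed.

(** Applied with e and f powers of s4, or of s1, chosen to bring the exponent sums of both entries
    to zero. *)
Lemma commutator_shift (G : groupType) (g h e f : G) :
    commute e h -> commute e f -> commute f g ->
  g * e * (h * f) * (g * e)^-1 * (h * f)^-1 = g * h * g^-1 * h^-1.
Proof.
move=> eh ef fg; have -> : g * e * (h * f) = g * h * f * e.
  by rewrite -!mulgA; congr (g * _); rewrite !mulgA eh -!mulgA ef.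
free_group_simpl; rewrite -(mulgA _ f) (commuteV fg).
by free_group_simpl.
Qed.

Section BraidsOnFiveStrands.
Variables (G : groupType) (s1 s2 s3 s4 : G).
Hypotheses (b12 : s1 * s2 * s1 = s2 * s1 * s2)
  (b23 : s2 * s3 * s2 = s3 * s2 * s3) (b34 : s3 * s4 * s3 = s4 * s3 * s4).
Hypotheses (c13 : commute s1 s3) (c14 : commute s1 s4) (c24 : commute s2 s4).
Hypothesis s14 : s1 <> s4.

Let x1 := s1 * s4^-1.
Let x2 := s2 * s4^-1.
Let y := s3 * s4^-1.
Let z := s3^-1 * s4.

(** Up to powers of s4 this is the commutator of s1 s2 and s1, and s1 s2 conjugates s1 to s2. *)
Let x21_comm : x2 * x1^-1 = (x1 * x2) * x1 * (x1 * x2)^-1 * x1^-1.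
Proof.
have -> : x1 * x2 = s1 * s2 * (s4^-1 * s4^-1).
  by rewrite /x1 /x2 !mulgA -(mulgA s1) -(commuteV c24) !mulgA.
rewrite commutator_shift ?b12; [by rewrite /x1 /x2; free_group_simpl | | |].
- by apply/commute_sym/commuteM; apply: commuteV.
- by rewrite /commute mulgA.
- by apply: commuteM; apply/commute_sym/commuteV.
Qed.

Let x1VE : x1^-1 = s4 * s1^-1.
Proof. by rewrite /x1; free_group_simpl. Qed.

Let s1Vs3 : commute s1^-1 s3.
Proof. by apply/commute_sym/commuteV/commute_sym. Qed.

Let s1Vs4 : commute s1^-1 s4.
Proof. by apply/commute_sym/commuteV/commute_sym. Qed.

(** Up to powers of s1 this is the commutator of s4 s3 and s4. *)
Let y_comm : y = let g := x1^-1 * y * x1^-1 in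
  g * x1^-1 * g^-1 * (x1^-1)^-1.
Proof.
have -> /= : x1^-1 * y * x1^-1 = s4 * s3 * (s1^-1 * s1^-1).
  rewrite x1VE /y; free_group_simpl.
  by rewrite -(mulgA s4) s1Vs3; free_group_simpl.
rewrite x1VE commutator_shift.
- have := congr1 (fun g => g * s3^-1 * s4^-1 * s4^-1) b34.
  by rewrite /y; free_group_simpl.
- by apply/commute_sym/commuteM; apply: commute_sym.
- by rewrite /commute mulgA.
- exact: commuteM.
Qed.

(** Up to powers of s1 this is the commutator of (s3 s4)^-1 and s4^-1. *)
Let z_comm : z = let g := (y * x1^-1 * x1^-1)^-1 in
  g * x1 * g^-1 * x1^-1.
Proof.
have -> /= : y * x1^-1 * x1^-1 = s3 * s4 * (s1^-1 * s1^-1).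
  rewrite x1VE /y; free_group_simpl.
  by rewrite -(mulgA s3) s1Vs4; free_group_simpl.
have gV : (s3 * s4 * (s1^-1 * s1^-1))^-1 = (s3 * s4)^-1 * (s1 * s1).
  have /commuteV gC : commute (s1 * s1) (s3 * s4).
    by apply/commute_sym/commuteM; apply/commute_sym/commuteM.
  by rewrite -gC; free_group_simpl.
rewrite gV (_ : x1 = s4^-1 * s1) ?commutator_shift.
- have := congr1 (fun g => g^-1 * s3 * s4 * s4) b34.
  by rewrite /z; free_group_simpl.
- by apply/commuteV/commute_sym/commuteM; apply: commute_sym.
- by rewrite /commute mulgA.
- by apply/commuteV/commuteM.
- exact/commuteV/commute_sym.
Qed.

(** This and [x2z] express the conjugates of x1 and x2 by s3 through x1, x2 and z, so that these
    conjugates lie in [H]. *)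
Let x1z : x1 * z = s3 * x1 * s3^-1.
Proof.
rewrite /x1 /z; free_group_simpl; rewrite -c13 -!mulgA; congr (s1 * _).
by rewrite !mulgA (braid_conjVJ b34).
Qed.

Let x2z : x2^-1 * z^-1 * x2 * z = s3 * x2 * s3^-1.
Proof.
transitivity (s2^-1 * s3 * s2 * (s4^-1 * s3^-1 * s4)).
  rewrite /x2 /z; free_group_simpl.
  have c24' : s4 * s2^-1 = s2^-1 * s4 by apply/commuteV/commute_sym.
  by rewrite c24' mulgK.
rewrite -(braid_conjVJ b34) -(braid_conj_sym b23) /x2.
by free_group_simpl.
Qed.

(* z * x2 = s3^-1 s2 is the commutator of s2 and s3, and the right-hand side is
   p (s3 p s3^-1)^-1 with p = x2 x1^-1 = s2 s1^-1, since s1 and s3 commute. *)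
Let zx2 : let g := x1 * z * (x2^-1 * z^-1 * x2 * z) in
  z * x2 = x2 * x1^-1 * (g * (x1 * z) * g^-1 * (x1 * z)^-1)^-1.
Proof.
rewrite x2z x1z /=.
have -> : (s3 * x1 * s3^-1 * (s3 * x2 * s3^-1) * (s3 * x1 * s3^-1) *
    (s3 * x1 * s3^-1 * (s3 * x2 * s3^-1))^-1 * (s3 * x1 * s3^-1)^-1)^-1 =
  s3 * (x1 * x2 * x1 * (x1 * x2)^-1 * x1^-1)^-1 * s3^-1.
  by clear; free_group_simpl.
rewrite -x21_comm /z /x1 /x2; free_group_simpl.
rewrite -(mulgA s2 _ s3) s1Vs3 -(mulgA s3^-1) -c24; free_group_simpl.
by rewrite (braid_conj_sym (esym b23)) mulgK.
Qed.

Let gens := [:: x1; x2; y; z].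
Let H : set G := smallest (@subgroup G) [set` gens]%classic.

(** A homomorphism from [H] to Z kills the commutators y, z and x2 x1^-1. By [zx2] it also kills z
    x2, hence x2 and then x1, so it is zero. [H] is nontrivial because s1 and s4 differ. *)
Lemma braid5_not_locally_indicable : ~ locally_indicable G.
Proof.
have Hgens g : g \in gens -> H g by move=> gg K [_]; apply.
have [H1 HM HV] : subgroup H.
  split=> [K [[]] //|g h Hg Hh K|g Hg K] [subK gensK].
    by case: (subK) => _ KM _; apply: KM; [apply: Hg | apply: Hh].
  by case: (subK) => _ _ KV; apply: KV; apply: Hg.
have Hx1 : H x1 by apply: Hgens; rewrite inE eqxx.
have Hx2 : H x2 by apply: Hgens; rewrite !inE eqxx orbT.
have Hy : H y by apply: Hgens; rewrite !inE eqxx !orbT.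
have Hz : H z by apply: Hgens; rewrite !inE eqxx !orbT.
move=> /(_ H) [//||| phi [phiM [g0 Hg0]]].
- by exists gens.
- exists x1 => // x1E; apply: s14; apply: (mulIg s4^-1).
  by rewrite -/x1 x1E mulgV.
case.
have phi1 : phi 1 = 0%R.
  by apply: (@GRing.addrI _ (phi 1)); rewrite -phiM // mulg1 GRing.addr0.
have phiV g : H g -> phi g^-1 = (- phi g)%R.
  move=> Hg; apply: (@GRing.addrI _ (phi g)).
  by rewrite -phiM ?mulgV ?phi1 ?GRing.subrr //; apply: HV.
have phiR g h : H g -> H h -> phi (g * h * g^-1 * h^-1) = 0%R.
  by move=> Hg Hh; rewrite !phiM ?phiV; auto 6; lia.
have phiy : phi y = 0%R.
  by rewrite y_comm phiR; auto 6.
have HF g h : H g -> H h -> H (g * h * g^-1 * h^-1) by auto 6.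
have phiz : phi z = 0%R by rewrite z_comm phiR; auto 6.
have phi21 : phi (x2 * x1^-1) = 0%R by rewrite x21_comm phiR; auto.
have phix2 : phi x2 = 0%R.
  have := phiM _ _ Hz Hx2; rewrite zx2 phiM ?phiV ?phiR; auto 8.
  by rewrite phi21 phiz; lia.
have phix1 : phi x1 = 0%R.
  by move: phi21 phix2; rewrite phiM ?phiV; auto; lia.
(* The kernel of phi is a subgroup containing the generators, hence contains the smallest such
   subgroup [H]. *)
pose K : set G := [set g | H g /\ phi g = 0%R]%classic.
suff : K g0 by case.
apply: Hg0; split.
  split=> [|g h [Hg g0'] [Hh h0]|g [Hg g0']]; split; auto.
    by rewrite phiM // g0' h0.
  by rewrite phiV // g0'.
move=> g gg; split; first exact: Hgens.
by move: gg; rewrite /= !inE => /or4P[] /eqP ->.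
Qed.

End BraidsOnFiveStrands.

(** * Permutation action of type B, separating generators *)

Definition adj_swap (i t : nat) : nat :=
  if t == i then i.+1 else if t == i.+1 then i else t.

Lemma adj_swapK i : involutive (adj_swap i).
Proof. by move=> t; rewrite /adj_swap; do !case: eqP; lia. Qed.

Lemma adj_swapC i j t : i.+2 <= j ->
  adj_swap i (adj_swap j t) = adj_swap j (adj_swap i t).
Proof. by rewrite /adj_swap; do !case: eqP; lia. Qed.

Lemma adj_swap_braid i t :
  adj_swap i (adj_swap i.+1 (adj_swap i t)) =
  adj_swap i.+1 (adj_swap i (adj_swap i.+1 t)).
Proof. by rewrite /adj_swap; do !case: eqP; lia. Qed.

Section ArtinBPermutation.
Variable n : nat.

(** The permutation action of the braid group on its strands, with the last generator acting
    trivially. *)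
Let swap_letter (l : 'I_n * bool) (t : nat) : nat :=
  if l.1.+1 < n then adj_swap l.1 t else t.

Let swapK l t : swap_letter l (swap_letter (inv_letter l) t) = t.
Proof. by rewrite /swap_letter /=; case: (_ < n) => //; apply: adj_swapK. Qed.

Let swapR u v : artinB_rel u v -> wact swap_letter u =1 wact swap_letter v.
Proof.
case=> {u v} i j; rewrite /wact /swap_letter /=.
- move=> ij t; case: (i.+1 < n); case: (j.+1 < n) => //.
  by case/orP: ij => ij; [|symmetry]; apply: adj_swapC.
- by move=> ij -> t; rewrite -ij ltn_ord ij adj_swap_braid.
- by move=> ij jn t; rewrite -ij ltn_ord jn ltnn !adj_swapK.
Qed.

(** The point i is moved by the generator i and fixed by the generator j. *)
Lemma artinB_ngen_neq i j : i.+1 < j -> j < n ->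
  ngen (@artinB_rel n) i <> ngen (@artinB_rel n) j.
Proof.
move=> ij jn; have lt_in : i < n by lia.
move/(congr1 (fun g => pact swap_letter g i)).
rewrite -(ngen_ltn _ lt_in) -(ngen_ltn _ jn) !(pact_gen swapK swapR).
by rewrite /swap_letter /adj_swap /=; do !case: ifP; lia.
Qed.

End ArtinBPermutation.

(** The relation of length four concerns the last two generators only, so for n >= 5 the first four
    satisfy the relations of the braid group on five strands. *)
Lemma artinB_not_locally_indicable n : 4 < n -> ~ locally_indicable (artinB n).
Proof.
move=> n5; pose b := ngen (@artinB_rel n).
apply: (@braid5_not_locally_indicable _ (b 0) (b 1%N) (b 2) (b 3)).
- by apply: artinB_ngen_braid; lia.
- by apply: artinB_ngen_braid; lia.
- by apply: artinB_ngen_braid; lia.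
- exact: artinB_ngenC.
- exact: artinB_ngenC.
- exact: artinB_ngenC.
- by apply: artinB_ngen_neq; lia.
Qed.

Theorem theorem4p8 (n : nat) (hn : 2 <= n) :
  locally_indicable (artinB n) <-> n <= 4.
Proof.
split=> [li | n4].
  by rewrite leqNgt; apply/negP => /artinB_not_locally_indicable.
apply: strongly_indicable_locally.
(* For n = 2, 3, 4 the quotient is the braid group on n strands, [artinA] of n - 1. *)
case: n hn n4 => [|[|[|[|[|n]]]]] // _ _; apply: strongly_indicable_artinB.
- exact: strongly_indicable_artinA1.
- exact: strongly_indicable_artinA2.
- exact: strongly_indicable_artinA3.
Qed.
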